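(* Let $X$ be a complete metric space and let $E\subseteq X$ be a $G_\delta$-set in $X$ which (with the subspace topology) is arcwise connected and locally arcwise connected. Then $E$ is a $B_1$-retract of $X$.
   Context: A function $f:X\to Y$ between topological spaces is a Baire-one function if it is the pointwise limit of a sequence of continuous functions $f_n:X\to Y$. A subset $E$ of $X$ (with the subspace topology) is a $B_1$-retract of $X$ if there exists a Baire-one function $r:X\to E$ with $r(x)=x$ for all $x\in E$. A space is locally arcwise connected if for every $x$ and every neighbourhood $U$ of $x$ there is a neighbourhood $V$ of $x$ such that every $y\in V$ is joined to $x$ by a path in $U$. *)

(* Defs.v *)
From Stdlib Require Import Reals.
Open Scope R_scope.

Definition is_metric {X : Type} (d : X -> X -> R) : Prop :=
  (forall x y, 0 <= d x y) /\
  (forall x y, d x y = 0 <-> x = y) /\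
  (forall x y, d x y = d y x) /\
  (forall x y z, d x z <= d x y + d y z).

Definition seq_converges {X : Type} (d : X -> X -> R) (u : nat -> X) (l : X) : Prop :=
  forall eps, 0 < eps -> exists N, forall n, (N <= n)%nat -> d (u n) l < eps.

Definition cauchy_seq {X : Type} (d : X -> X -> R) (u : nat -> X) : Prop :=
  forall eps, 0 < eps -> exists N, forall m n, (N <= m)%nat -> (N <= n)%nat ->
    d (u m) (u n) < eps.

Definition complete {X : Type} (d : X -> X -> R) : Prop :=
  forall u, cauchy_seq d u -> exists l, seq_converges d u l.

Definition is_open {X : Type} (d : X -> X -> R) (O : X -> Prop) : Prop :=
  forall x, O x -> exists eps, 0 < eps /\ forall y, d x y < eps -> O y.

Definition G_delta {X : Type} (d : X -> X -> R) (E : X -> Prop) : Prop :=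
  exists O : nat -> X -> Prop, (forall n, is_open d (O n)) /\
    (forall x, E x <-> forall n, O n x).

(* continuity of f : X -> X (metric topology); for maps with values in a
   subset E this is the same as continuity into E with the subspace topology *)
Definition continuous_map {X : Type} (d : X -> X -> R) (f : X -> X) : Prop :=
  forall x eps, 0 < eps -> exists delta, 0 < delta /\
    forall y, d x y < delta -> d (f x) (f y) < eps.

Definition path_in {X : Type} (d : X -> X -> R) (E : X -> Prop)
  (g : R -> X) (x y : X) : Prop :=
  g 0 = x /\ g 1 = y /\
  (forall t, 0 <= t <= 1 -> E (g t)) /\
  (forall t eps, 0 <= t <= 1 -> 0 < eps -> exists delta, 0 < delta /\
     forall s, 0 <= s <= 1 -> Rabs (s - t) < delta -> d (g s) (g t) < eps).

(* an arc: an injective path (homeomorphic image of [0,1], [0,1] compact) *)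
Definition arc_in {X : Type} (d : X -> X -> R) (E : X -> Prop)
  (g : R -> X) (x y : X) : Prop :=
  path_in d E g x y /\
  (forall s t, 0 <= s <= 1 -> 0 <= t <= 1 -> g s = g t -> s = t).

Definition arcwise_connected {X : Type} (d : X -> X -> R) (E : X -> Prop) : Prop :=
  (exists x, E x) /\
  (forall x y, E x -> E y -> x <> y -> exists g, arc_in d E g x y).

Definition nbhd_in {X : Type} (d : X -> X -> R) (E : X -> Prop) (x : X)
  (U : X -> Prop) : Prop :=
  exists eps, 0 < eps /\ forall y, E y -> d x y < eps -> U y.

Definition loc_arcwise_connected {X : Type} (d : X -> X -> R) (E : X -> Prop) : Prop :=
  forall x U, E x -> nbhd_in d E x U ->
    exists V, nbhd_in d E x V /\
      forall y, E y -> V y ->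
        exists g, path_in d (fun z => E z /\ U z) g x y.

Definition B1_retract {X : Type} (d : X -> X -> R) (E : X -> Prop) : Prop :=
  exists r : X -> X,
    (forall x, E (r x)) /\ (forall x, E x -> r x = x) /\
    exists f : nat -> X -> X,
      (forall n x, E (f n x)) /\ (forall n, continuous_map d (f n)) /\
      (forall x, seq_converges d (fun n => f n x) (r x)).

(* Main.v *)
(** Fix radii [rho n a <= 2^-n] such that the ball of radius [rho (n+1) a] lies
    in the [n]-th open set [O n], where [E] is the intersection of the [O n], and
    such that points of [E] in the ball of radius [2 rho n a] about [a] are joined
    to [a] by a path of size [2^-n].  If a point lies in the balls of level [n]
    about [a] and of level [n+1] about [b], then [a] and [b] are joined by a small
    path.  Let [r x] be [x] on [E]; off [E], let it be the first center, in a
    well-order of [X], of a ball containing [x], at the last level before balls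
    fail to cover [x].  For [c > 0], shrink the balls by [c]: the resulting
    first-center cells of one level are at mutual distance at least [c].  Hence a
    map that is constant near each cell can be corrected level by level, moving
    along the connecting paths in a thin collar of the points covered at all
    levels up to the next one.  The collars are thinner than [c], so they miss
    every point not covered by the balls of that level; as [c] tends to 0 these
    continuous maps converge to [r]. *)

Require Import Defs.
From Stdlib Require Import Reals Lra Lia Wf_nat Classical ClassicalEpsilon.
From mathcomp Require eqtype boolp wochoice.
Open Scope R_scope.

(** * Well-orderings of an arbitrary type *)

Lemma well_order_exists (X : Type) :
  exists lt : X -> X -> Prop,
    (forall a b, a <> b -> lt a b \/ lt b a) /\
    (forall P : X -> Prop, (exists a, P a) ->
      exists a, P a /\ forall b, P b -> ~ lt b a).
Proof.
  destruct (wochoice.well_ordering_principle (eqtype.Equality.Pack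
    (eqtype.Equality.Class (boolp.gen_eqMixin X)))) as [R HR]. simpl in R.
  assert (Hmin : forall P : X -> Prop, (exists a, P a) -> exists a, P a /\
            (forall b, P b -> R a b = true) /\
            (forall a', P a' -> (forall b, P b -> R a' b = true) -> a = a')).
  { intros P [a Ha].
    destruct (HR (fun x => boolp.asbool (P x))) as [m [[Pm Rm] Um]].
    - exists a. exact (boolp.asboolT Ha).
    - exists m. split; [exact (boolp.asboolW Pm)|]. split.
      + intros b Hb. apply Rm. exact (boolp.asboolT Hb).
      + intros a' Ha' Hb. apply Um. split; [exact (boolp.asboolT Ha')|].
        intros b Pb. apply Hb. exact (boolp.asboolW Pb). }
  (* The strict order is the failure of the reverse weak relation. If both [R a b] and [R b a] held,
     then [a] and [b] would both be least in the pair, and uniqueness of the least element would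
     identify them. *)
  exists (fun a b => R b a <> true). split.
  - intros a b Hab. destruct (classic (R b a = true)) as [Hba|]; [|now left].
    right. intro Rab. apply Hab.
    assert (Rrefl : forall y, R y y = true).
    { intro y. destruct (Hmin (fun x => x = y)) as [m [-> [Rm _]]]; eauto. }
    destruct (Hmin (fun x => x = a \/ x = b)) as [m [_ [_ Um]]]; [eauto|].
    rewrite <- (Um a); [|tauto|intros ? [->| ->]; auto].
    apply Um; [tauto|intros ? [->| ->]; auto].
  - intros P HP. destruct (Hmin P HP) as [a [Pa [Ra _]]].
    exists a. split; [exact Pa|]. intros b Pb Hn. exact (Hn (Ra b Pb)).
Qed.

(** * Projection of the line onto the unit interval *)

Definition clamp (t : R) : R := Rmax 0 (Rmin 1 t).

Lemma clamp_range (t : R) : 0 <= clamp t <= 1.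
Proof. unfold clamp, Rmax, Rmin; repeat destruct Rle_dec; lra. Qed.

Lemma clamp_lipschitz (s t : R) : Rabs (clamp s - clamp t) <= Rabs (s - t).
Proof.
  unfold clamp, Rmax, Rmin, Rabs;
    repeat destruct Rle_dec; repeat destruct Rcase_abs; lra.
Qed.

Lemma clamp_nonpos (t : R) : t <= 0 -> clamp t = 0.
Proof. unfold clamp, Rmax, Rmin; repeat destruct Rle_dec; lra. Qed.

Lemma clamp_ge1 (t : R) : 1 <= t -> clamp t = 1.
Proof. unfold clamp, Rmax, Rmin; repeat destruct Rle_dec; lra. Qed.

(** * Paths and truncated distances in a metric space *)

Section MetricSpace.

Context {X : Type} (d : X -> X -> R) (Hd : is_metric d).

Lemma metric_sym (x y : X) : d x y = d y x.
Proof. apply Hd. Qed.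

Lemma metric_triangle (x y z : X) : d x z <= d x y + d y z.
Proof. apply Hd. Qed.

Lemma metric_nonneg (x y : X) : 0 <= d x y.
Proof. apply Hd. Qed.

Lemma metric_refl (x : X) : d x x = 0.
Proof. now apply Hd. Qed.

Lemma path_const (F : X -> Prop) (x : X) : F x -> path_in d F (fun _ => x) x x.
Proof.
  intro Fx. repeat split; auto.
  intros t eps _ Heps. exists 1. split; [lra|]. intros. now rewrite metric_refl.
Qed.

Lemma path_rev (F : X -> Prop) (g : R -> X) (x y : X) :
  path_in d F g x y -> path_in d F (fun t => g (1 - t)) y x.
Proof.
  intros [g0 [g1 [gF gc]]]. repeat split.
  - now rewrite Rminus_0_r.
  - now rewrite Rminus_diag.
  - intros t Ht. apply gF. lra.
  - intros t eps Ht Heps. destruct (gc (1 - t) eps) as [delta [Hdelta H]]; [lra|easy|].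
    exists delta. split; [easy|]. intros s Hs Hst. apply H; [lra|].
    replace (1 - s - (1 - t)) with (- (s - t)) by ring. now rewrite Rabs_Ropp.
Qed.

Lemma path_weaken (F G : X -> Prop) (g : R -> X) (x y : X) :
  (forall z, F z -> G z) -> path_in d F g x y -> path_in d G g x y.
Proof. intros FG [g0 [g1 [gF gc]]]. repeat split; auto. Qed.

(* The truncation at 1 makes the empty set harmless. *)
Lemma truncated_dist_exists (S : X -> Prop) :
  exists psi : X -> R,
    (forall x z, S z -> psi x <= d x z) /\
    (forall x t, psi x < t -> t <= 1 -> exists z, S z /\ d x z < t) /\
    (forall x y, Rabs (psi x - psi y) <= d x y).
Proof.
  set (L := fun x m => m <= 1 /\ forall z, S z -> m <= d x z).
  assert (HL : forall x, exists m, is_lub (L x) m).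
  { intro x. destruct (completeness (L x)) as [m Hm].
    - exists 1. intros m [Hm _]. exact Hm.
    - exists 0. split; [lra|]. intros. apply metric_nonneg.
    - now exists m. }
  apply choice in HL. destruct HL as [psi Hpsi].
  assert (Hle1 : forall x, psi x <= 1) by (intro x; apply Hpsi; intros m [Hm _]; exact Hm).
  assert (HleS : forall x z, S z -> psi x <= d x z)
    by (intros x z Sz; apply Hpsi; intros m [_ Hm]; auto).
  assert (Hlip : forall x y, psi x - psi y <= d x y).
  { intros x y.
    assert (psi x - d x y <= psi y); [|lra].
    apply Hpsi. split.
    - specialize (Hle1 x). pose proof (metric_nonneg x y). lra.
    - intros z Sz. specialize (HleS x z Sz). pose proof (metric_triangle x y z). lra. }
  exists psi. split; [exact HleS|]. split.
  - intros x t Ht Ht1. apply NNPP. intro Hno.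
    assert (t <= psi x); [|lra].
    apply Hpsi. split; [exact Ht1|]. intros z Sz.
    destruct (Rle_or_lt t (d x z)); [easy|]. exfalso. apply Hno. eauto.
  - intros x y. apply Rabs_le. pose proof (Hlip x y). pose proof (Hlip y x).
    rewrite (metric_sym y x) in *. lra.
Qed.

(** * Gluing the levels for a fixed separation [c] of the cells *)

Section Gluing.

Context (E : X -> Prop) (p : X) (c : R) (C : nat -> X -> X -> Prop)
  (gam : nat -> X -> X -> R -> X)
  (Hc : 0 < c <= 1)
  (C0 : forall z a, C 0%nat z a <-> a = p)
  (CE : forall n z a, C n z a -> E a)
  (Csep : forall n z z' a a', C n z a -> C n z' a' -> d z z' < c -> a = a')
  (Hgam : forall n a b, E a -> E b -> path_in d E (gam n a b) a b).

(* [C n z a] reads: [z] lies in the cell of level [n] with center [a]. *)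
Definition deep (n : nat) (z : X) : Prop :=
  forall i, (i <= n)%nat -> exists a, C i z a.

(** Two admissible [z] are less than [c] apart, so [Csep] makes the value unique; where there is no
    admissible [z] it is arbitrary. *)
Definition center (n : nat) (x : X) : X :=
  epsilon (inhabits p) (fun a => exists z, deep n z /\ d x z < c / 2 /\ C n z a).

(** The ratio [/ 4] puts each collar inside the zone where the preceding transition has reached its
    endpoint. The factor [c / 4] leaves room to move a point of a collar by [c / 4] without changing
    its centers. *)
Definition width (n : nat) : R := c / 4 * (/ 4) ^ n.

Definition deep_dist (n : nat) : X -> R :=
  proj1_sig (constructive_indefinite_description _ (truncated_dist_exists (deep n))).

(* On the collar both centers are locally constant, and there the previous map
   already equals its center; so the two branches agree where they meet. *)
Fixpoint glued (n : nat) (x : X) : X :=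
  match n with
  | O => p
  | S m =>
      if Rlt_dec (deep_dist (S m) x) (width m)
      then gam m (center m x) (center (S m) x)
             (clamp (2 - 4 * deep_dist (S m) x / width m))
      else glued m x
  end.

Lemma Ep : E p.
Proof. apply (CE 0 p). now apply C0. Qed.

Lemma width_pos (n : nat) : 0 < width n.
Proof. unfold width. pose proof (pow_lt (/ 4) n). nra. Qed.

Lemma width_S (n : nat) : width (S n) = width n / 4.
Proof. unfold width. simpl. field. Qed.

Lemma width_le (n : nat) : width n <= c / 4.
Proof.
  induction n as [|n IH]; [unfold width; simpl; lra|].
  rewrite width_S. pose proof (width_pos n). lra.
Qed.

Lemma deep_dist_spec (n : nat) :
  (forall x z, deep n z -> deep_dist n x <= d x z) /\
  (forall x t, deep_dist n x < t -> t <= 1 -> exists z, deep n z /\ d x z < t) /\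
  (forall x y, Rabs (deep_dist n x - deep_dist n y) <= d x y).
Proof.
  exact (proj2_sig (constructive_indefinite_description _
    (truncated_dist_exists (deep n)))).
Qed.

Lemma deep_dist_le (n : nat) (x z : X) : deep n z -> deep_dist n x <= d x z.
Proof. apply deep_dist_spec. Qed.

Lemma deep_dist_lt (n m : nat) (x : X) :
  deep_dist n x < width m -> exists z, deep n z /\ d x z < width m.
Proof. intro Hlt. apply deep_dist_spec; [easy|]. pose proof (width_le m). lra. Qed.

Lemma deep_dist_lipschitz (n : nat) (x y : X) :
  Rabs (deep_dist n x - deep_dist n y) <= d x y.
Proof. apply deep_dist_spec. Qed.

Lemma deep_le (n m : nat) (z : X) : (n <= m)%nat -> deep m z -> deep n z.
Proof. intros Hnm H i Hi. apply H. lia. Qed.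

Lemma center_eq (n : nat) (x z a : X) :
  deep n z -> d x z < c / 2 -> C n z a -> center n x = a.
Proof.
  intros Dz Hxz Ca.
  assert (Hex : exists a, exists z, deep n z /\ d x z < c / 2 /\ C n z a) by eauto.
  destruct (epsilon_spec (inhabits p) _ Hex) as [z' [_ [Hxz' Ca']]].
  refine (Csep n z' z _ _ Ca' Ca _).
  pose proof (metric_triangle z' x z). rewrite (metric_sym z' x) in *. lra.
Qed.

Lemma center_spec (n : nat) (x z : X) :
  deep n z -> d x z < c / 2 -> C n z (center n x).
Proof.
  intros Dz Hxz. destruct (Dz n (le_n n)) as [a Ca].
  now rewrite (center_eq n x z a).
Qed.

Lemma near_width (n : nat) (x z : X) : d x z < width n -> d x z < c / 2.
Proof. pose proof (width_le n). lra. Qed.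

Lemma transition_path (n : nat) (x z : X) :
  deep (S n) z -> d x z < c / 2 ->
  path_in d E (gam n (center n x) (center (S n) x)) (center n x) (center (S n) x).
Proof.
  intros Dz Hxz. apply Hgam; eapply CE; apply center_spec; eauto using deep_le.
Qed.

(** For [n = S m], the distance to the deep set is below [width m / 4], so the path parameter is
    clamped to 1 and the path is at its endpoint. *)
Lemma glued_near_deep (n : nat) (x z : X) :
  deep n z -> d x z < width n -> glued n x = center n x.
Proof.
  destruct n as [|n]; intros Dz Hxz; simpl.
  - symmetry. apply (center_eq 0 x z); [easy|now apply near_width in Hxz|now apply C0].
  - pose proof (deep_dist_le _ x z Dz). pose proof (width_S n). pose proof (width_pos n).
    destruct Rlt_dec as [_|Hn]; [|lra].
    rewrite clamp_ge1.
    + apply (transition_path n x z Dz). now apply near_width in Hxz.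
    + apply Rmult_le_reg_r with (width n); [lra|].
      field_simplify; lra.
Qed.

(** On the outer half of the collar the parameter is clamped to 0, and the path starts at the center
    that [glued n] already takes there. Agreement on this whole half leaves a margin for continuity
    at the edge. *)
Lemma glued_S_far (n : nat) (x : X) :
  width n / 2 <= deep_dist (S n) x -> glued (S n) x = glued n x.
Proof.
  intro Hfar. simpl. destruct Rlt_dec as [Hlt|_]; [|easy].
  destruct (deep_dist_lt _ _ _ Hlt) as [z [Dz Hxz]].
  rewrite clamp_nonpos.
  - rewrite (glued_near_deep n x z); [|apply (deep_le n (S n)); auto|easy].
    apply (transition_path n x z Dz). now apply near_width in Hxz.
  - pose proof (width_pos n).
    apply Rmult_le_reg_r with (width n); [lra|]. field_simplify; lra.
Qed.

Lemma glued_in (n : nat) (x : X) : E (glued n x).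
Proof.
  induction n as [|n IH]; simpl; [exact Ep|].
  destruct Rlt_dec as [Hlt|_]; [|exact IH].
  destruct (deep_dist_lt _ _ _ Hlt) as [z [Dz Hxz]]. apply near_width in Hxz.
  apply (transition_path n x z Dz Hxz). apply clamp_range.
Qed.

Lemma glued_continuous (n : nat) : continuous_map d (glued n).
Proof.
  induction n as [|n IH]; intros x eps Heps.
  - exists 1. split; [lra|]. intros. simpl. now rewrite metric_refl.
  - pose proof (width_pos n) as Hw. pose proof (width_le n) as Hwc.
    destruct (Rlt_or_le (deep_dist (S n) x) (width n)) as [Hlt|Hge].
    + destruct (deep_dist_lt _ _ _ Hlt) as [z [Dz Hxz]].
      assert (Hxz' : d x z < c / 2) by lra.
      destruct (transition_path n x z Dz Hxz') as [_ [_ [_ gc]]].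
      set (tt := fun y => clamp (2 - 4 * deep_dist (S n) y / width n)).
      destruct (gc (tt x) eps (clamp_range _) Heps) as [delta [Hdelta Hg]].
      (* The first bound lets [x] and [y] share the witness [z], hence both centers; the second
         keeps [y] in the collar; the third offsets the slope [4 / width n] of the path
         parameter. *)
      exists (Rmin (Rmin (c / 4) (width n - deep_dist (S n) x)) (delta * (width n / 4))).
      split; [repeat apply Rmin_glb_lt; nra|].
      intros y Hy.
      assert (Hy1 : d x y < c / 4 /\ d x y < width n - deep_dist (S n) x /\
                    d x y < delta * (width n / 4)).
      { revert Hy. unfold Rmin. repeat destruct Rle_dec; lra. }
      destruct Hy1 as [Hy1 [Hy2 Hy3]].
      pose proof (deep_dist_lipschitz (S n) y x) as Hlip.
      rewrite (metric_sym y x) in Hlip.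
      pose proof (Rle_abs (deep_dist (S n) y - deep_dist (S n) x)).
      assert (Hyz : d y z < c / 2).
      { pose proof (metric_triangle y x z). rewrite (metric_sym y x) in *. lra. }
      destruct (Dz n ltac:(lia)) as [a Ca]. destruct (Dz (S n) (le_n _)) as [b Cb].
      assert (Dz' : deep n z) by (apply (deep_le n (S n)); auto).
      simpl. destruct Rlt_dec; [|lra]. destruct Rlt_dec; [|lra].
      change (d (gam n (center n x) (center (S n) x) (tt x))
                (gam n (center n y) (center (S n) y) (tt y)) < eps).
      rewrite (center_eq n y z a), (center_eq (S n) y z b),
        <- (center_eq n x z a), <- (center_eq (S n) x z b) by easy.
      rewrite metric_sym. apply Hg; [apply clamp_range|].
      apply Rle_lt_trans with (1 := clamp_lipschitz _ _).
      replace (2 - 4 * deep_dist (S n) y / width n - (2 - 4 * deep_dist (S n) x / width n))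
        with (- ((deep_dist (S n) y - deep_dist (S n) x) * (4 / width n))) by (field; lra).
      assert (0 < 4 / width n) by (apply Rdiv_lt_0_compat; lra).
      rewrite Rabs_Ropp, Rabs_mult, (Rabs_pos_eq (4 / width n)) by lra.
      apply Rle_lt_trans with (d x y * (4 / width n)); [nra|].
      replace delta with (delta * (width n / 4) * (4 / width n)) by (field; lra).
      nra.
    + destruct (IH x eps Heps) as [delta [Hdelta H]].
      exists (Rmin delta (width n / 2)). split; [apply Rmin_glb_lt; lra|].
      intros y Hy.
      assert (Hy1 : d x y < delta /\ d x y < width n / 2).
      { revert Hy. unfold Rmin. destruct Rle_dec; lra. }
      pose proof (deep_dist_lipschitz (S n) x y).
      pose proof (Rle_abs (deep_dist (S n) x - deep_dist (S n) y)).
      rewrite !glued_S_far by lra. now apply H.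
Qed.

Lemma glued_deep (n : nat) (x : X) : deep n x -> C n x (glued n x).
Proof.
  intro Dx. pose proof (width_pos n).
  rewrite (glued_near_deep n x x); [|easy|now rewrite metric_refl].
  apply center_spec; [easy|]. rewrite metric_refl. lra.
Qed.

(** Every later collar surrounds a subset of the points deep at level [S n] and is thinner than [c],
    so it misses [x]. *)
Lemma glued_stable (n m : nat) (x : X) :
  (n <= m)%nat -> (forall z, deep (S n) z -> c <= d x z) -> glued m x = glued n x.
Proof.
  intros Hnm Hfar. induction Hnm as [|m Hnm IH]; [easy|].
  simpl. destruct Rlt_dec as [Hlt|_]; [|exact IH].
  destruct (deep_dist_lt _ _ _ Hlt) as [z [Dz Hxz]].
  specialize (Hfar z (deep_le (S n) (S m) z ltac:(lia) Dz)).
  pose proof (width_le m). lra.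
Qed.

(** Errors do not accumulate over the levels: a collar containing [x] resets the value to a point of
    a path within [eta] of some [z] near [x], and otherwise the value is unchanged. *)
Lemma glued_close (n m : nat) (x : X) (eta : R) :
  (n <= m)%nat -> deep n x ->
  (forall a, C n x a -> d x a <= eta) ->
  (forall j z a b t, (n <= j)%nat -> C j z a -> C (S j) z b -> 0 <= t <= 1 ->
     d z (gam j a b t) <= eta) ->
  d x (glued m x) <= eta + c.
Proof.
  intros Hnm Dx Hn Hpath. induction Hnm as [|m Hnm IH].
  - specialize (Hn _ (glued_deep n x Dx)). lra.
  - simpl. destruct Rlt_dec as [Hlt|_]; [|exact IH].
    destruct (deep_dist_lt _ _ _ Hlt) as [z [Dz Hxz]]. apply near_width in Hxz.
    set (t := clamp _).
    pose proof (metric_triangle x z (gam m (center m x) (center (S m) x) t)).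
    pose proof (Hpath m z (center m x) (center (S m) x) t Hnm
      (center_spec m x z (deep_le m (S m) z ltac:(lia) Dz) Hxz)
      (center_spec (S m) x z Dz Hxz) (clamp_range _)).
    lra.
Qed.

End Gluing.

(** * Choice of radii and of connecting paths *)

Lemma radius_exists (E : X -> Prop) (O : nat -> X -> Prop) :
  (forall n, is_open d (O n)) -> (forall x, E x -> forall n, O n x) ->
  loc_arcwise_connected d E ->
  exists rho : nat -> X -> R, forall n a, E a ->
    0 < rho n a <= (/ 2) ^ n /\
    (forall y, d a y < rho n a -> O (pred n) y) /\
    (forall y, E y -> d a y < 2 * rho n a ->
      exists g, path_in d (fun z => E z /\ d a z < (/ 2) ^ n) g a y).
Proof.
  intros HO EO HL.
  set (Q := fun (q : nat * X) r => E (snd q) ->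
    0 < r <= (/ 2) ^ fst q /\
    (forall y, d (snd q) y < r -> O (pred (fst q)) y) /\
    (forall y, E y -> d (snd q) y < 2 * r ->
      exists g, path_in d (fun z => E z /\ d (snd q) z < (/ 2) ^ fst q) g (snd q) y)).
  destruct (choice Q) as [rho Hrho].
  - intros [n a]. unfold Q. simpl.
    destruct (classic (E a)) as [Ea|]; [|now exists 0].
    assert (Hpow : 0 < (/ 2) ^ n) by (apply pow_lt; lra).
    destruct (HO (pred n) a (EO a Ea _)) as [e1 [He1 H1]].
    destruct (HL a (fun z => d a z < (/ 2) ^ n) Ea) as [V [[e2 [He2 HV]] H2]];
      [now exists ((/ 2) ^ n)|].
    exists (Rmin ((/ 2) ^ n) (Rmin e1 (e2 / 2))). intros _.
    pose proof (Rmin_l ((/ 2) ^ n) (Rmin e1 (e2 / 2))).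
    pose proof (Rmin_r ((/ 2) ^ n) (Rmin e1 (e2 / 2))).
    pose proof (Rmin_l e1 (e2 / 2)). pose proof (Rmin_r e1 (e2 / 2)).
    split; [split; [repeat apply Rmin_glb_lt; lra|easy]|]. split.
    + intros y Hy. apply H1. lra.
    + intros y Ey Hy. apply H2; [easy|]. apply HV; [easy|]. lra.
  - exists (fun n a => rho (n, a)). intros n a. exact (Hrho (n, a)).
Qed.

(** When the balls meet, the distance of their centers is less than twice the larger radius, so the
    path property at the center of the larger ball applies, reversed if that center is [b]. *)
Lemma connecting_paths_exist (E : X -> Prop) (rho : nat -> X -> R) :
  arcwise_connected d E ->
  (forall n a, E a -> 0 < rho n a <= (/ 2) ^ n) ->
  (forall n a y, E a -> E y -> d a y < 2 * rho n a ->
    exists g, path_in d (fun z => E z /\ d a z < (/ 2) ^ n) g a y) ->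
  exists gam : nat -> X -> X -> R -> X, forall n a b, E a -> E b ->
    path_in d E (gam n a b) a b /\
    (d a b < rho n a + rho (S n) b ->
      forall t, 0 <= t <= 1 -> d a (gam n a b t) <= 2 * (/ 2) ^ n).
Proof.
  intros [[p Ep] Harc] Hrho Hpath.
  set (Q := fun (q : nat * X * X) g =>
    let '(n, a, b) := q in E a -> E b ->
    path_in d E g a b /\
    (d a b < rho n a + rho (S n) b ->
      forall t, 0 <= t <= 1 -> d a (g t) <= 2 * (/ 2) ^ n)).
  destruct (choice Q) as [gam Hgam].
  - intros [[n a] b]. unfold Q.
    destruct (classic (E a /\ E b)) as [[Ea Eb]|]; [|exists (fun _ => p); tauto].
    destruct (Rlt_or_le (d a b) (rho n a + rho (S n) b)) as [Hlt|Hge].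
    + pose proof (Hrho n a Ea). pose proof (Hrho (S n) b Eb) as Hb. simpl in Hb.
      destruct (Rlt_or_le (rho n a) (rho (S n) b)) as [Hab|Hab].
      * destruct (Hpath (S n) b a Eb Ea) as [g Hg]; [rewrite (metric_sym b a); lra|].
        apply path_rev in Hg. exists (fun t => g (1 - t)). intros _ _. split.
        -- revert Hg. now apply path_weaken.
        -- intros _ t Ht. destruct Hg as [_ [_ [Hg _]]].
           specialize (Hg t Ht). simpl in Hg.
           pose proof (metric_triangle a b (g (1 - t))). lra.
      * destruct (Hpath n a b Ea Eb) as [g Hg]; [lra|].
        exists g. intros _ _. split.
        -- revert Hg. now apply path_weaken.
        -- intros _ t Ht. destruct Hg as [_ [_ [Hg _]]].
           specialize (Hg t Ht). lra.
    (* No size bound is required here, but [arcwise_connected] supplies arcs only between distinct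
       points. *)
    + destruct (classic (a = b)) as [<-|Hab].
      * exists (fun _ => a). intros _ _. split; [now apply path_const|lra].
      * destruct (Harc a b Ea Eb Hab) as [g [Hg _]]. exists g. split; [easy|lra].
  - exists (fun n a b => gam (n, a, b)). intros n a b. exact (Hgam (n, a, b)).
Qed.

Lemma inv_INR_S_lt (eps : R) :
  0 < eps -> exists K, forall k, (K <= k)%nat -> / INR (S k) < eps.
Proof.
  intro Heps. destruct (archimed_cor1 eps Heps) as [K [HK HK0]].
  exists K. intros k Hk. apply Rle_lt_trans with (2 := HK).
  apply Rinv_le_contravar; [now apply lt_0_INR|]. apply le_INR. lia.
Qed.

Lemma inv_INR_S_range (k : nat) : 0 < / INR (S k) <= 1.
Proof.
  assert (1 <= INR (S k)) by (apply (le_INR 1); lia).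
  split; [apply Rinv_0_lt_compat; lra|]. rewrite <- Rinv_1.
  apply Rinv_le_contravar; lra.
Qed.

(** * First-center cells and convergence of the approximations *)

Section Retraction.

Context (E : X -> Prop) (p : X) (lt : X -> X -> Prop) (rho : nat -> X -> R)
  (Ep : E p)
  (lt_total : forall a b, a <> b -> lt a b \/ lt b a)
  (lt_min : forall P : X -> Prop, (exists a, P a) ->
     exists a, P a /\ forall b, P b -> ~ lt b a)
  (Hrho : forall n a, E a -> 0 < rho n a <= (/ 2) ^ n).

(* Level 0 is the whole space, with center [p]. *)
Definition cell (c : R) (n : nat) (z a : X) : Prop :=
  match n with
  | O => a = p
  | S _ => E a /\ d z a <= rho n a - c /\
           forall a', E a' -> lt a' a -> rho n a' <= d z a'
  end.

Definition covered (n : nat) (z : X) : Prop :=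
  match n with
  | O => True
  | S _ => exists a, E a /\ d z a < rho n a
  end.

Lemma cell_in (c : R) (n : nat) (z a : X) : cell c n z a -> E a.
Proof. destruct n; simpl; [now intros ->|tauto]. Qed.

(** If [a] precedes [a'], then [z] lies in the ball about [a] shrunk by [c], while [z'] lies outside
    the full ball. *)
Lemma cell_separated (c : R) (n : nat) (z z' a a' : X) :
  cell c n z a -> cell c n z' a' -> d z z' < c -> a = a'.
Proof.
  destruct n as [|n]; simpl; [now intros -> ->|].
  intros [Ea [Ha La]] [Ea' [Ha' La']] Hzz.
  apply NNPP. intro Hne. destruct (lt_total a a' Hne) as [Hlt|Hlt].
  - specialize (La' a Ea Hlt). pose proof (metric_triangle z' z a).
    rewrite (metric_sym z' z) in *. lra.
  - specialize (La a' Ea' Hlt). pose proof (metric_triangle z z' a'). lra.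
Qed.

(** The first full ball containing [x] contains it strictly, hence still does after a small enough
    shrinking; its center does not depend on [k]. *)
Lemma covered_cell (n : nat) (x : X) :
  covered n x -> exists a K, forall k, (K <= k)%nat -> cell (/ INR (S k)) n x a.
Proof.
  destruct n as [|n]; simpl; [now exists p, 0%nat|].
  intro Hcov. destruct (lt_min _ Hcov) as [a [[Ea Ha] La]].
  destruct (inv_INR_S_lt (rho (S n) a - d x a)) as [K HK]; [lra|].
  exists a, K. intros k Hk. specialize (HK k Hk). repeat split; [easy|simpl in *; lra|].
  intros a' Ea' Hlt. apply Rnot_lt_le. intro Hn. exact (La a' (conj Ea' Hn) Hlt).
Qed.

Lemma covered_deep (n : nat) (x : X) :
  (forall i, (i <= n)%nat -> covered i x) ->
  exists K, forall k, (K <= k)%nat -> deep (cell (/ INR (S k))) n x.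
Proof.
  induction n as [|n IH]; intro Hcov.
  - exists 0%nat. intros k _ i Hi. exists p. replace i with 0%nat by lia. easy.
  - destruct IH as [K1 HK1]; [auto|].
    destruct (covered_cell (S n) x) as [a [K2 HK2]]; [auto|].
    exists (max K1 K2). intros k Hk i Hi.
    destruct (Nat.eq_dec i (S n)) as [->|Hne].
    + exists a. apply HK2. lia.
    + apply HK1; lia.
Qed.

(** A point less than [c] away from a shrunk ball lies in the full ball. This supplies the distance
    hypothesis of [glued_stable]. *)
Lemma uncovered_far (c : R) (n : nat) (x z : X) :
  ~ covered n x -> deep (cell c) n z -> c <= d x z.
Proof.
  intros Hunc Dz. destruct (Dz n (le_n n)) as [a Ca].
  destruct n as [|n]; simpl in *; [tauto|].
  destruct Ca as [Ea [Ha _]]. apply Rnot_lt_le. intro Hlt.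
  apply Hunc. exists a. split; [easy|].
  pose proof (metric_triangle x z a). lra.
Qed.

Context (gam : nat -> X -> X -> R -> X)
  (Hgam : forall n a b, E a -> E b ->
    path_in d E (gam n a b) a b /\
    (d a b < rho n a + rho (S n) b ->
      forall t, 0 <= t <= 1 -> d a (gam n a b t) <= 2 * (/ 2) ^ n)).

(** A single index makes the shrinking tend to 0 and the number of levels tend to infinity. *)
Definition approx (k : nat) : X -> X :=
  glued p (/ INR (S k)) (cell (/ INR (S k))) gam k.

Lemma approx_in (k : nat) (x : X) : E (approx k x).
Proof.
  apply (glued_in E p _ _ gam (inv_INR_S_range k)).
  - reflexivity.
  - apply cell_in.
  - apply cell_separated.
  - apply Hgam.
Qed.

Lemma approx_continuous (k : nat) : continuous_map d (approx k).
Proof.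
  apply (glued_continuous E p _ _ gam (inv_INR_S_range k)).
  - reflexivity.
  - apply cell_in.
  - apply cell_separated.
  - apply Hgam.
Qed.

Lemma cell_dist (k n : nat) (z a : X) :
  (1 <= n)%nat -> cell (/ INR (S k)) n z a -> d z a < rho n a.
Proof.
  intros Hn Ca. destruct n as [|n]; [lia|].
  pose proof (inv_INR_S_range k). unfold cell in Ca. lra.
Qed.

Lemma approx_converges_on (x : X) :
  E x -> seq_converges d (fun k => approx k x) x.
Proof.
  intros Ex eps Heps.
  destruct (pow_lt_1_zero (/ 2) ltac:(rewrite Rabs_pos_eq; lra) (eps / 6)) as [n Hn]; [lra|].
  specialize (Hn (S n) ltac:(lia)).
  rewrite Rabs_pos_eq in Hn by (apply pow_le; lra).
  destruct (covered_deep (S n) x) as [K1 HK1].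
  { intros [|i] _; simpl; [easy|]. exists x. rewrite metric_refl. split; [easy|].
    now apply Hrho. }
  destruct (inv_INR_S_lt (eps / 2)) as [K2 HK2]; [lra|].
  exists (max (S n) (max K1 K2)). intros k Hk.
  specialize (HK2 k ltac:(lia)).
  rewrite metric_sym.
  (* Of the factor 3, one unit bounds the distance from a point to its center and two bound the path
     from that center. Each summand is below [eps / 2]. *)
  apply Rle_lt_trans with (3 * (/ 2) ^ S n + / INR (S k)); [|lra].
  apply (glued_close E p _ _ gam (inv_INR_S_range k)) with (n := S n).
  - reflexivity.
  - apply cell_in.
  - apply cell_separated.
  - apply Hgam.
  - lia.
  - apply HK1. lia.
  - intros a Ca. pose proof (cell_dist k (S n) x a ltac:(lia) Ca).
    pose proof (Hrho (S n) a (cell_in _ _ _ _ Ca)).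
    assert (0 < (/ 2) ^ S n) by (apply pow_lt; lra). lra.
  - intros j z a b t Hj Ca Cb Ht.
    pose proof (cell_dist k j z a ltac:(lia) Ca) as Ha.
    pose proof (cell_dist k (S j) z b ltac:(lia) Cb) as Hb.
    pose proof (cell_in _ _ _ _ Ca) as Ea. pose proof (cell_in _ _ _ _ Cb) as Eb.
    destruct (Hgam j a b Ea Eb) as [_ Hg].
    pose proof (metric_triangle a z b) as Hab. rewrite (metric_sym a z) in Hab.
    specialize (Hg ltac:(lra) t Ht).
    pose proof (metric_triangle z a (gam j a b t)).
    pose proof (Hrho j a Ea).
    assert ((/ 2) ^ j <= (/ 2) ^ S n).
    { rewrite !pow_inv. apply Rinv_le_contravar; [apply pow_lt; lra|].
      apply Rle_pow; [lra|lia]. }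
    lra.
Qed.

(** The sequence is eventually constant: past the last level [n] before coverage fails no collar
    reaches [x], and at level [n] the value is the center of its cell. *)
Lemma approx_converges_off (x : X) (m : nat) :
  ~ covered m x -> exists l, E l /\ seq_converges d (fun k => approx k x) l.
Proof.
  intro Hm.
  assert (Hleast : exists n, ~ covered (S n) x /\ forall i, (i <= n)%nat -> covered i x).
  { destruct (dec_inh_nat_subset_has_unique_least_element (fun i => ~ covered i x))
      as [n [[Hn Hmin] _]]; [intro; apply classic|eauto|].
    (* Level 0 covers everything, so the first failing level is a successor. *)
    destruct n as [|n]; [simpl in Hn; tauto|].
    exists n. split; [easy|]. intros i Hi. apply NNPP. intro Hi'.
    specialize (Hmin i Hi'). lia. }
  destruct Hleast as [n [Hn Hcov]].
  destruct (covered_deep n x Hcov) as [K1 HK1].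
  destruct (covered_cell n x) as [a [K2 HK2]]; [auto|].
  exists a. split; [exact (cell_in _ _ _ _ (HK2 K2 (le_n _)))|].
  intros eps Heps. exists (max n (max K1 K2)). intros k Hk.
  assert (approx k x = a) as ->; [|now rewrite metric_refl].
  unfold approx.
  rewrite (glued_stable p _ _ gam (inv_INR_S_range k) n k);
    [|lia|intro z; now apply uncovered_far].
  apply (cell_separated (/ INR (S k)) n x x); [| |].
  - apply (glued_deep E p _ _ gam (inv_INR_S_range k)).
    + reflexivity.
    + apply cell_in.
    + apply cell_separated.
    + apply Hgam.
    + apply HK1. lia.
  - apply HK2. lia.
  - rewrite metric_refl. apply inv_INR_S_range.
Qed.

End Retraction.

End MetricSpace.

Theorem theorem3p4 (X : Type) (d : X -> X -> R) (E : X -> Prop) :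
  is_metric d -> complete d -> G_delta d E ->
  arcwise_connected d E -> loc_arcwise_connected d E ->
  B1_retract d E.
Proof.
  intros Hd _ [O [HO EO]] Harc Hloc.
  destruct (well_order_exists X) as [lt [lt_total lt_min]].
  destruct (radius_exists d E O HO) as [rho Hrho]; [now intros x Ex; apply EO|easy|].
  destruct (connecting_paths_exist d Hd E rho Harc) as [gam Hgam];
    [apply Hrho|intros n a y Ea; now apply Hrho|].
  destruct (proj1 Harc) as [p Ep].
  assert (Hrho' : forall n a, E a -> 0 < rho n a <= (/ 2) ^ n) by apply Hrho.
  set (f := approx d Hd E p lt rho gam).
  assert (Hlim : forall x, exists l,
    E l /\ (E x -> l = x) /\ seq_converges d (fun k => f k x) l).
  { intro x. destruct (classic (E x)) as [Ex|Hx].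
    - exists x. repeat split; auto. now apply approx_converges_on.
    - destruct (not_all_ex_not _ _ (fun H => Hx (proj2 (EO x) H))) as [n Hn].
      (* The balls of level [S n] lie in [O n], which misses [x]. *)
      destruct (approx_converges_off d Hd E p lt rho Ep lt_total lt_min gam Hgam x (S n))
        as [l [El Hl]].
      + intros [a [Ea Ha]]. apply Hn. apply (Hrho (S n) a Ea).
        now rewrite metric_sym.
      + exists l. tauto. }
  apply choice in Hlim. destruct Hlim as [r Hr].
  exists r. split; [apply Hr|]. split; [apply Hr|].
  exists f. split; [|split; [|apply Hr]].
  - intros n x. now apply approx_in.
  - intro n. now apply approx_continuous.
Qed.
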